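(* Let $\gamma \ge 0$, let $M$ be a positive integer, and let $\beta \in (0, 1/M]$. For every $\gamma$-resettable scheduling problem, the randomized online algorithm $\textsc{Disc}(\gamma, M, \beta)$ is $c$-competitive with \[ c = 1 + \frac{1}{M}\sum_{j=1}^{M} (2+\gamma)^{j/M}, \] that is, for every input $\mathcal{I}$, $\mathbf{E}[\mathrm{cost}_{\textsc{Disc}(\gamma,M,\beta)}(\mathcal{I})] \le c \cdot \mathrm{cost}_{\mathrm{OPT}}(\mathcal{I})$.
   Context: \textbf{$\gamma$-resettable scheduling.} Jobs are handled by an executor that has a set of states, one of which is a distinguished initial state; the executor is in the initial state at time $0$. An input $\mathcal{I}$ is a sequence (also viewed as a set) of jobs released over time; each job $r$ has an arrival time $a(r)$, a weight $w(r)\ge 0$, and possibly other parameters determining its execution. A job cannot be started before its arrival time. $C_{A}(r)$ denotes the completion time of job $r$ under a schedule/algorithm $A$, and the cost is $\mathrm{cost}_A(\mathcal{I})=\sum_{r\in\mathcal{I}} w(r) C_A(r)$. For a time $\tau$, $\mathcal{I}_\tau$ is the set of jobs arriving by time $\tau$. An auxiliary $\tau$-schedule is a problem-specific feasible way of executing a subset of jobs of $\mathcal{I}_\tau$ that starts at time $0$, terminates at time $\tau$, and leaves no job partially executed; $R(A)$ denotes the set of jobs completed by a $\tau$-schedule $A$ when run from time $0$. The problem is $\gamma$-resettable if: (Delayed execution) whenever the executor is in the initial state at a time $t$, it can execute any auxiliary $\tau$-schedule with $\tau\le t$ during $[t,t+\tau)$, and a job completed at time $z$ by the schedule run from time $0$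 is now completed at time $t+z$ (unless already executed before); (Resetting) if the executor was in the initial state at time $t$ and executed a $\tau$-schedule ending at $t+\tau$, it can be returned to the initial state using extra time $\gamma\tau$, i.e., it is in the initial state at time $t+(1+\gamma)\tau$; (Learning minimum) $\min(\mathcal{I})$, the earliest time at which an optimal offline solution may complete some job, satisfies $\min(\mathcal{I})>0$ and is learned by an online algorithm at or before time $\min(\mathcal{I})$. \textbf{Online setting.} An online algorithm at time $t$ knows only jobs arrived by time $t$ and does not know the number of jobs in advance. A (randomized) online algorithm is $c$-competitive if for every input $\mathcal{I}$ its (expected) cost is at most $c\cdot\mathrm{cost}_{\mathrm{OPT}}(\mathcal{I})$, where $\mathrm{OPT}$ is an optimal offline solution. \textbf{Auxiliary schedules $S_\tau$.} For a $\tau$-schedule $A$, $\mathrm{val}_\tau(A)=\sum_{r\in R(A)} w(r)C_A(r) + \tau\cdot w(\mathcal{I}_\tau\setminus R(A))$, where $w(R)=\sum_{r\in R}w(r)$. $S_\tau$ is a $\tau$-schedule minimizing $\mathrm{val}_\tau$, ties broken arbitrarily but deterministically. \textbf{Routine $\textsc{Mimic}(\gamma,\omega)$}, $\omega\in(-1,0]$: let $\alpha=2+\gamma$ and $\tau_k=\min(\mathcal{I})\cdot\alpha^{k+\omega}$. It does nothing until time $\tau_1$. For each $k\ge 1$, at time $\tau_k$ (when the executor is in the initial state) it computes $S_{\tau_k}$, executes it during $[\tau_k,2\tau_k)$ (without interruption or modification by later jobs), serving only those jobs of $S_{\tau_k}$ not served earlier, and then resets the executor in time $\gamma\tau_k$,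 so it is in the initial state at time $\alpha\tau_k=\tau_{k+1}$. \textbf{Algorithm $\textsc{Disc}(\gamma,M,\beta)$}: chooses an integer $m\in\{0,\dots,M-1\}$ uniformly at random and runs $\textsc{Mimic}(\gamma, \omega=-1+m/M+\beta)$.
   Formalization: Made explicit: the executor may idle in the initial state; any feasible execution cut at time τ, dropping jobs unfinished by then, yields a τ-schedule (else the claim fails); τ-schedules respect arrival times; min(I) is the earliest completion time over all feasible offline executions. *)

(* Defs.v *)
From HB Require Import structures.
From mathcomp Require Import all_boot all_order all_algebra finmap.
From mathcomp Require Import all_classical all_reals all_analysis.

Set Implicit Arguments.
Unset Strict Implicit.
Unset Printing Implicit Defensive.

Import Order.TTheory GRing.Theory Num.Theory.

Local Open Scope classical_set_scope.
Local Open Scope ring_scope.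

(* What the executor does during [0, now]: its state at each time, and, for each
   job, the time at which its execution starts and the time at which it is
   completed (+oo if this does not happen by time [now]).  The values of [traj]
   outside [0, now] are irrelevant. *)
Record history (R : realType) (J S : Type) := History {
  now : R;
  traj : R -> S;
  start : J -> \bar R;
  compl : J -> \bar R }.

Definition completed (R : realType) (J S : Type) (h : history R J S) (r : J)
  : bool := (compl h r < +oo)%E.

Definition extends (R : realType) (J S : Type) (h h' : history R J S) : Prop :=
  [/\ now h <= now h',
      forall t, 0 <= t <= now h -> traj h' t = traj h t,
      forall r, if (start h r < +oo)%E then start h' r = start h r
                else ((now h)%:E <= start h' r)%E
    & forall r, if completed h r then compl h' r = compl h r
                else ((now h)%:E <= compl h' r)%E].

(* Doing nothing, in state [s], during [0, t]. *)
Definition idle (R : realType) (J S : Type) (s : S) (t : R) : history R J S :=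
  History t (fun=> s) (fun=> +oo%E) (fun=> +oo%E).

(* [job] is the universe of all possible jobs; an input is a finite set of jobs.
   [feasible h] says that the executor, started at time 0, can act as in [h].
   [executes h A h'] says that [h'] is obtained from [h] by executing the
   auxiliary schedule [A] from time [now h] on, serving only the jobs not
   completed in [h]; it is constrained by [delayed_execution] below.
   [feasible_truncate] expresses that auxiliary schedules are the feasible ways
   of executing jobs that leave no job partially executed: running any feasible
   execution up to time tau, without the jobs not completed by then (and with
   idling if it is shorter than tau), is one of them. *)
Record problem (R : realType) := Problem {
  job : choiceType;
  arrival : job -> R;
  weight : job -> R;
  state : Type;
  init : state;
  feasible : history R job state -> Prop;
  executes : history R job state -> history R job state ->
             history R job state -> Prop;
  arrival_ge0 : forall r, 0 <= arrival r;
  weight_ge0 : forall r, 0 <= weight r;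
  feasible_time0 : forall h, feasible h -> 0 <= now h /\ traj h 0 = init;
  feasible_job : forall h, feasible h -> forall r,
    [/\ ((arrival r)%:E <= start h r)%E,
        (start h r <= compl h r)%E,
        (start h r < +oo -> start h r <= (now h)%:E)%E
      & (compl h r < +oo -> compl h r <= (now h)%:E)%E];
  feasible_idle : forall t, 0 <= t -> feasible (idle job init t);
  feasible_truncate : forall h tau, feasible h -> 0 <= tau ->
    exists A, [/\ feasible A, now A = tau,
      forall r, compl A r = if (compl h r <= tau%:E)%E then compl h r else +oo%E
      & forall r, (start A r < +oo)%E -> completed A r] }.

Definition hist (R : realType) (P : problem R) : Type :=
  history R (job P) (state P).
Notation input P := {fset job P}.

Section Scheduling.
Variables (R : realType) (P : problem R).
Implicit Types (I K : input P) (h A : hist P) (tau t omega gamma beta : R).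

Definition at_init h : Prop := traj h (now h) = init P.

Definition arrived I tau : input P := [fset r in I | arrival r <= tau]%fset.

Definition execution I h : Prop :=
  feasible h /\ forall r, (start h r < +oo)%E -> r \in I.

(* Total weighted completion time for completion times [C].  A job which is
   never completed has completion time +oo, and 0 * +oo = 0, so that only jobs
   of positive weight matter. *)
Definition cost I (C : job P -> \bar R) : \bar R :=
  (\sum_(r <- I) (weight r)%:E * C r)%E.

Definition offline_solution I h : Prop :=
  execution I h /\ forall r, r \in I -> completed h r.

Definition optimal I h : Prop :=
  offline_solution I h /\
  forall h', offline_solution I h' -> (cost I (compl h) <= cost I (compl h'))%E.

(* The earliest time at which an offline execution of [I] may complete a job.
   The infimum is not restricted to executions that turn out to be optimal:
   those depend on the jobs released later, and auxiliary schedules might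
   complete a job earlier than they do. *)
Definition min_time I : R :=
  inf [set c : R | exists h r, execution I h /\ compl h r = c%:E].

Definition tau_schedule I tau A : Prop :=
  [/\ execution (arrived I tau) A, now A = tau
    & forall r, (start A r < +oo)%E -> completed A r].

Definition aux_val I tau A : R :=
  \sum_(r <- arrived I tau | completed A r) weight r * fine (compl A r)
  + tau * \sum_(r <- arrived I tau | ~~ completed A r) weight r.

Definition best_schedule I tau A : Prop :=
  tau_schedule I tau A /\
  forall B, tau_schedule I tau B -> aux_val I tau A <= aux_val I tau B.

Definition delayed_execution : Prop := forall I h tau A,
  execution I h -> at_init h -> tau_schedule I tau A -> tau <= now h ->
  (exists h', executes h A h') /\
  forall h', executes h A h' ->
    [/\ execution I h', extends h h', now h' = now h + tau
      & forall r, compl h' r = if completed h r then compl h r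
                               else ((now h)%:E + compl A r)%E].

(* [h''] continues [h'] by returning, in time [d], to the initial state. *)
Definition reset_in I (d : R) (h' h'' : hist P) : Prop :=
  [/\ execution I h'', extends h' h'', now h'' = now h' + d, at_init h''
    & forall r, compl h'' r = compl h' r].

Definition resetting gamma : Prop := forall I h tau A h',
  execution I h -> at_init h -> tau_schedule I tau A -> tau <= now h ->
  executes h A h' -> exists h'', reset_in I (gamma * tau) h' h''.

(* [min_time I] is positive and determined by the jobs arriving by that time,
   hence known to an online algorithm then. *)
Definition learning_minimum : Prop := forall I, I != fset0 ->
  0 < min_time I /\
  forall I', arrived I' (min_time I) = arrived I (min_time I) ->
    min_time I' = min_time I.

Definition resettable gamma : Prop :=
  [/\ delayed_execution, resetting gamma & learning_minimum].

Definition tau_ gamma omega I (k : nat) : R :=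
  min_time I * (2 + gamma) `^ (k%:R + omega).

(* [H k] is the history, at time tau_(k+1), of a run of Mimic(gamma, omega) on
   [I]; [S K tau] is the schedule S_tau computed from the set [K] of the jobs
   arrived by time [tau]. *)
Definition mimic (S : input P -> R -> hist P) gamma omega I (H : nat -> hist P)
  : Prop :=
  H 0%N = idle (job P) (init P) (tau_ gamma omega I 1%N) /\
  forall k : nat, let tau := tau_ gamma omega I k.+1 in
    exists2 h', executes (H k) (S (arrived I tau) tau) h'
              & reset_in I (gamma * tau) h' (H k.+1).

Definition run_compl (H : nat -> hist P) (r : job P) : \bar R :=
  ereal_inf [set compl (H k) r | k in [set: nat]].

(* Disc(gamma, M, beta) when the random integer is [m]. *)
Definition disc (S : input P -> R -> hist P) gamma (M : nat) beta (m : 'I_M) I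
  (H : nat -> hist P) : Prop :=
  mimic S gamma (-1 + (m : nat)%:R / M%:R + beta) I H.

(* Expected cost on [I] if a run of [H] is chosen uniformly at random. *)
Definition expected_cost (M : nat) I (H : 'I_M -> nat -> hist P) : \bar R :=
  ((M%:R^-1)%:E * \sum_(m < M) cost I (run_compl (H m)))%E.

End Scheduling.

Arguments delayed_execution {R} P.
Arguments resetting {R} P gamma.
Arguments learning_minimum {R} P.
Arguments resettable {R} P gamma.

(* Main.v *)
(** Write X_t(s) for the weighted sum over I of the completion times in S_t
    capped at s, and u_t for the weight of the jobs of I not completed by S_t.
    Truncating executions gives X_s(s) <= X_t(s) and X_s(s) <= OPT.  In a run
    of Mimic, a job first served in phase k completes at tau_k + z, with z its
    completion time in S_(tau_k).
    - The terms z contribute at most OPT: by induction on k, the capped cost of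
      the z of the jobs served in phases <= k is at most X_(tau_k)(tau_k), since
      passing from k-1 to k costs at most
      X_(tau_k)(tau_k) - X_(tau_k)(tau_(k-1)).
    - The terms tau_k contribute at most
      tau_1 w(I) + sum_k (tau_(k+1) - tau_k) u_(tau_k).  With
      q = (2 + gamma)^(1/M), the times tau_k of all M runs form one geometric
      sequence s_n = s_0 q^n (n >= 1), where s_0 <= min(I) because
      beta <= 1/M.  Hence the contributions of the M runs add up to
      (q + ... + q^M) (s_0 w(I) + sum_n (s_(n+1) - s_n) u_(s_(n+1))), and the
      last factor, truncated at N, is at most X_(s_N)(s_N) <= OPT. *)

Require Import Defs.
From HB Require Import structures.
From mathcomp Require Import all_boot all_order all_algebra finmap.
From mathcomp Require Import all_classical all_reals all_analysis.
From mathcomp Require Import ring lra.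

Set Implicit Arguments.
Unset Strict Implicit.
Unset Printing Implicit Defensive.

Import Order.TTheory GRing.Theory Num.Theory.

Local Open Scope ring_scope.

(** * Completion times capped at a horizon *)

(** [fine] sends +oo to 0, so an infinite completion time is treated apart and capped to [t]. *)
Definition capped (R : realType) (t : R) (c : \bar R) : R :=
  if (c < +oo)%E then Num.min (fine c) t else t.

(** X_t(s) is this sum at cap s for the completion times of S_t. Jobs not yet arrived are charged
    the cap too, which makes different horizons comparable. *)
Definition capped_cost (R : realType) (T : Type) (I : seq T) (w : T -> R)
  (C : T -> \bar R) (t : R) : R := \sum_(r <- I) w r * capped t (C r).

Section Capped.
Variables (R : realType).
Implicit Types (s t : R) (c : \bar R).

Lemma capped_le t c : capped t c <= t.
Proof. by rewrite /capped; case: ifP => // _; rewrite ge_min lexx orbT. Qed.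

Lemma cappedy t : capped t +oo%E = t.
Proof. by rewrite /capped ltxx. Qed.

Lemma le_capped s t c : s <= t -> capped s c <= capped t c.
Proof.
move=> st; rewrite /capped; case: ifP => // _.
by rewrite le_min !ge_min lexx st orbT.
Qed.

Lemma capped_le_fine t c : (c < +oo)%E -> capped t c <= fine c.
Proof. by rewrite /capped => ->; rewrite ge_min lexx. Qed.

Lemma capped_id t c : (c < +oo)%E -> (c <= t%:E)%E -> 0 <= t ->
  capped t c = fine c.
Proof.
rewrite /capped => -> ct t0; apply/min_idPl.
by case: c ct => [x| |].
Qed.

Lemma capped_step s t c : s <= t ->
  capped s c + (t - s) * (c == +oo%E)%:R <= capped t c.
Proof.
move=> st; have [->|_] := eqVneq c +oo%E.
  by rewrite !cappedy ?eqxx ?mulr1; lra.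
by rewrite mulr0 addr0 le_capped.
Qed.

Lemma capped_ge t c : (t%:E <= c)%E -> capped t c = t.
Proof.
rewrite /capped; case: c => [x| |] //=.
by rewrite lee_fin ltry => /min_idPr.
Qed.

End Capped.

(** * Serving times and start times over successive phases *)

(* For phases i < k running schedules with completion times [C i] (+oo for a job
   which is not served): [first_compl C k r] is the entry of the first phase
   serving [r], and [first_start C tau k r] the start of this phase, or [tau k]
   if there is none. *)
Fixpoint first_compl (R : realType) (T : Type) (C : nat -> T -> \bar R) k r :=
  if k is k'.+1 then
    if (first_compl C k' r < +oo)%E then first_compl C k' r else C k' r
  else +oo%E.

Lemma first_complS (R : realType) (T : Type) (C : nat -> T -> \bar R) k r :
  first_compl C k.+1 r =
  if (first_compl C k r < +oo)%E then first_compl C k r else C k r.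
Proof. by []. Qed.

Arguments first_compl : simpl never.

Fixpoint first_start (R : realType) (T : Type) (C : nat -> T -> \bar R)
    (tau : nat -> R) k r :=
  if k is k'.+1 then
    if (first_compl C k r < +oo)%E then first_start C tau k' r else tau k
  else tau 0%N.

Section Phases.
Variables (R : realType) (T : Type) (I : seq T) (w : T -> R).
Variables (C : nat -> T -> \bar R) (tau : nat -> R).
Hypotheses (w_ge0 : forall r, 0 <= w r) (tau_ge0 : forall k, 0 <= tau k).
Hypothesis tau_homo : forall k, tau k <= tau k.+1.
Hypothesis C_le : forall k r, (C k r < +oo -> C k r <= (tau k)%:E)%E.
Hypothesis C_mono :
  forall k, capped_cost I w (C k) (tau k) <= capped_cost I w (C k.+1) (tau k).

Lemma first_compl_le k r :
  (first_compl C k.+1 r < +oo -> first_compl C k.+1 r <= (tau k)%:E)%E.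
Proof.
elim: k => [|k IH]; first by rewrite first_complS; exact: C_le.
rewrite first_complS; case: ifP => [Dy _|_].
  by rewrite (le_trans (IH _)) // lee_fin.
exact: C_le.
Qed.

Lemma first_startE k r : ~~ (first_compl C k r < +oo)%E ->
  first_start C tau k r = tau k.
Proof. by case: k => //= k /negbTE ->. Qed.

(** The start moves from [tau i] to [tau i.+1] only if the job is still unserved, and then the
    schedule of phase [i] in particular omits it. *)
Lemma first_start_le k r : first_start C tau k r <=
  tau 0%N + \sum_(0 <= i < k) (tau i.+1 - tau i) * (C i r == +oo%E)%:R.
Proof.
elim: k => [|k IH]; first by rewrite big_geq// addr0.
have inc : 0 <= (tau k.+1 - tau k) * (C k r == +oo%E)%:R.
  by rewrite mulr_ge0// subr_ge0.
rewrite big_nat_recr//= first_complS addrA.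
case: (boolP (first_compl C k r < +oo)%E) => Dy.
  by rewrite Dy (le_trans IH)// lerDl.
case: ifP => Cy; first by rewrite (le_trans IH)// lerDl.
have -> : C k r = +oo%E by apply/eqP; rewrite -leye_eq leNgt Cy.
by rewrite eqxx mulr1; move: IH; rewrite first_startE//; lra.
Qed.

Lemma capped_cost_first_compl k :
  capped_cost I w (first_compl C k.+1) (tau k) <= capped_cost I w (C k) (tau k).
Proof.
elim: k => [|k IH]; first by [].
(* This holds job by job. A job served before has the same capped entry at both caps, and its capped
   value in the new schedule grows with the cap. A job not served before counts [tau k] at the old
   cap, at least its capped value in the new schedule. *)
have step : capped_cost I w (first_compl C k.+2) (tau k.+1) <=
    capped_cost I w (C k.+1) (tau k.+1)
    + (capped_cost I w (first_compl C k.+1) (tau k)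
       - capped_cost I w (C k.+1) (tau k)).
  rewrite /capped_cost -sumrB -big_split /=; apply: ler_sum => r _.
  rewrite -mulrBr -mulrDr; apply: ler_wpM2l => //.
  rewrite [first_compl C k.+2 r]first_complS; case: ifP => Dy.
    have Dk := first_compl_le Dy.
    have Dk1 : (first_compl C k.+1 r <= (tau k.+1)%:E)%E.
      by rewrite (le_trans Dk)// lee_fin.
    rewrite !(capped_id (c := first_compl C k.+1 r))//.
    by have := le_capped (C k.+1 r) (tau_homo k); lra.
  have -> : first_compl C k.+1 r = +oo%E.
    by apply/eqP; rewrite -leye_eq leNgt Dy.
  by rewrite cappedy lerDl subr_ge0 capped_le.
by move: step (C_mono k) IH; lra.
Qed.

(** Initially every job is charged [tau 0]. Each step passes to the next schedule at the old cap by
    [C_mono], then raises the cap, which charges the jobs omitted by that next schedule the whole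
    increment. *)
Lemma capped_cost_unserved N :
  (forall r, ((tau 0%N)%:E <= C 0%N r)%E) ->
  tau 0%N * \sum_(r <- I) w r
  + \sum_(0 <= n < N) (tau n.+1 - tau n)
      * (\sum_(r <- I) w r * (C n.+1 r == +oo%E)%:R)
  <= capped_cost I w (C N) (tau N).
Proof.
move=> C0; elim: N => [|N IH].
  rewrite big_geq// addr0 /capped_cost mulr_sumr; apply: ler_sum => r _.
  by rewrite capped_ge// mulrC.
rewrite big_nat_recr//= addrA (le_trans (lerD IH (lexx _)))//.
rewrite (le_trans (lerD (C_mono N) (lexx _)))//.
rewrite /capped_cost mulr_sumr -big_split /=; apply: ler_sum => r _.
rewrite mulrCA -mulrDr; apply: ler_wpM2l => //.
exact: capped_step.
Qed.

End Phases.

(** * Summation over the common geometric sequence *)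

(** With n = kM + m, a difference on the left is s q^(n+1) (q^M - 1), that is, q + ... + q^M times s
    q^(n+1) - s q^n. The pairs (k, m) enumerate all n < KM. *)
Lemma geometric_phases (R : realType) (q s W : R) (u : nat -> R) (M K : nat) :
  \sum_(0 <= m < M) (s * q ^+ m.+1 * W
    + \sum_(0 <= k < K) (s * q ^+ (k.+1 * M + m).+1 - s * q ^+ (k * M + m).+1)
        * u (k * M + m)%N)
  = (\sum_(1 <= j < M.+1) q ^+ j)
    * (s * W + \sum_(0 <= n < K * M) (s * q ^+ n.+1 - s * q ^+ n) * u n).
Proof.
have QE : \sum_(1 <= j < M.+1) q ^+ j = q * \sum_(i < M) q ^+ i.
  rewrite big_add1 /= big_mkord mulr_sumr; apply: eq_bigr => i _.
  by rewrite exprS.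
rewrite big_split mulrDr /=; congr (_ + _).
  rewrite big_add1 mulr_suml; apply: eq_bigr => i _; ring.
rewrite exchange_big big_nat_mul mulr_sumr /=; apply: eq_bigr => k _.
rewrite mulr_sumr -{3}[(k * M)%N]add0n mulSn big_addn addnK.
apply: eq_bigr => m _; rewrite (addnC m).
have -> : (M + k * M + m).+1 = (M + (k * M + m).+1)%N by rewrite addnS addnA.
rewrite exprD exprS QE.
have -> : q ^+ M = (q - 1) * \sum_(i < M) q ^+ i + 1 by rewrite -subrX1 subrK.
ring.
Qed.

(** * Executions and optimal auxiliary schedules *)

Section Schedules.
Variables (R : realType) (P : problem R).
Implicit Types (I : input P) (h A : hist P) (tau : R) (r : job P).

Lemma sum_arrived I tau (p : pred (job P)) (F : job P -> R) :
  \sum_(r <- arrived I tau | p r) F r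
  = \sum_(r <- I | (arrival r <= tau) && p r) F r.
Proof. by rewrite big_mkcond big_fset /= -big_mkcondr. Qed.

Lemma compl_notin I h r : execution I h -> r \notin I -> compl h r = +oo%E.
Proof.
move=> [fh hI]; apply: contraNeq => rh; apply: hI.
by have [_ sc _ _] := feasible_job fh r; rewrite (le_lt_trans sc)// ltey.
Qed.

Lemma arrival_le_compl h r : feasible h -> ((arrival r)%:E <= compl h r)%E.
Proof. by move=> fh; have [+ + _ _] := feasible_job fh r; exact: le_trans. Qed.

Lemma compl_ge0 h r : feasible h -> (0 <= compl h r)%E.
Proof.
by move=> fh; rewrite (le_trans _ (arrival_le_compl r fh))// lee_fin arrival_ge0.
Qed.

Lemma tau_schedule_execution I tau A : tau_schedule I tau A -> execution I A.
Proof.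
by move=> [[fA hA] _ _]; split=> // r /hA; rewrite !inE => /andP[].
Qed.

Lemma tau_schedule_compl I tau A r : tau_schedule I tau A ->
  (compl A r < +oo -> compl A r <= tau%:E)%E.
Proof. by move=> [[fA _] <- _]; have [] := feasible_job fA r. Qed.

(** Jobs arriving after [tau] pay [tau] in every [tau]-schedule, so both objectives differ by a
    constant and have the same minimizers. *)
Lemma capped_cost_aux_val I tau A : 0 <= tau -> tau_schedule I tau A ->
  capped_cost I (@weight R P) (compl A) tau
  = aux_val I tau A + tau * \sum_(r <- I | ~~ (arrival r <= tau)) weight r.
Proof.
move=> tau0 sA; rewrite /aux_val !sum_arrived !mulr_sumr.
rewrite [in RHS]big_mkcond [X in _ + X + _]big_mkcond [X in _ + _ + X]big_mkcond.
rewrite -!big_split; apply: eq_bigr => r _ /=.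
case: (boolP (arrival r <= tau)) => /= ra.
  rewrite /completed; case: ifPn => cA /=.
    by rewrite capped_id ?addr0// (tau_schedule_compl sA).
  by rewrite /capped (negbTE cA) add0r addr0 mulrC.
have [eA _ _] := sA.
rewrite (compl_notin eA) ?cappedy ?add0r ?addr0 1?mulrC//.
by rewrite !inE negb_and ra orbT.
Qed.

(** Truncating [h] at [tau] gives a [tau]-schedule of the same capped cost: a job completed later is
    charged [tau] either way. *)
Lemma best_capped_cost I tau A h : 0 <= tau -> best_schedule I tau A ->
  execution I h ->
  capped_cost I (@weight R P) (compl A) tau
  <= capped_cost I (@weight R P) (compl h) tau.
Proof.
move=> tau0 [sA bA] [fh hI].
have [B [fB nB cB sB]] := feasible_truncate fh tau0.
have tB : tau_schedule I tau B.
  split=> //; split=> // r /sB; rewrite /completed cB.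
  case: ifP => // ct _; rewrite !inE; apply/andP; split.
    by apply: hI; have [_ sc _ _] := feasible_job fh r;
      rewrite (le_lt_trans sc)// (le_lt_trans ct)// ltry.
  by rewrite -lee_fin (le_trans (arrival_le_compl r fh)).
have -> : capped_cost I (@weight R P) (compl h) tau
          = capped_cost I (@weight R P) (compl B) tau.
  apply: eq_bigr => r _; rewrite cB; case: ifPn => //.
  by rewrite -ltNge => /ltW ct; rewrite cappedy capped_ge.
by rewrite !capped_cost_aux_val// lerD2r bA.
Qed.

Lemma min_time_ge0 I : 0 <= min_time I.
Proof.
rewrite /min_time; set E := (X in inf X).
have lb : lbound E 0.
  by move=> c [h [r [[fh _] rc]]]; have := compl_ge0 r fh; rewrite rc lee_fin.
have [E0|nE0] := pselect (E !=set0)%classic; first exact: lb_le_inf.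
(* If no execution completes a job, the infimum takes its default value 0. *)
by rewrite inf_out// => -[].
Qed.

Lemma min_time_le I h r : execution I h -> ((min_time I)%:E <= compl h r)%E.
Proof.
move=> eh; have [fh _] := eh; have := compl_ge0 r fh.
case E : (compl h r) => [c| |]// _; last by rewrite leey.
rewrite lee_fin; apply: ge_inf; last by exists h, r.
exists 0 => c' [h' [r' [[fh' _] rc]]].
by have := compl_ge0 r' fh'; rewrite rc lee_fin.
Qed.

(** * Phase times and their growth *)

Lemma tau_S gamma omega I k : 0 <= gamma ->
  tau_ gamma omega I k.+1 = (2 + gamma) * tau_ gamma omega I k.
Proof.
move=> g0; rewrite /tau_ mulrCA; congr (_ * _).
have a0 : 2 + gamma != 0 by apply/lt0r_neq0; lra.
rewrite -[k.+1%:R]natr1 [k%:R + 1 + omega]addrAC.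
rewrite (@powRD _ _ _ 1) ?a0 ?implybT// powRr1; last lra.
by rewrite mulrC.
Qed.

(** The exponent k + 1 + omega equals (kM + m + 1)/M + (beta - 1/M), so all offsets [m] share one
    geometric sequence. *)
Lemma tau_geometric gamma omega (M m : nat) beta I k : 0 <= gamma -> (0 < M)%N ->
  omega = -1 + m%:R / M%:R + beta ->
  tau_ gamma omega I k.+1 = min_time I * (2 + gamma) `^ (beta - M%:R^-1)
                            * ((2 + gamma) `^ M%:R^-1) ^+ (k * M + m).+1.
Proof.
move=> g0 M0 ->; have a0 : 2 + gamma != 0 by apply/lt0r_neq0; lra.
have Mn0 : M%:R != 0 :> R by rewrite pnatr_eq0 -lt0n.
rewrite -powR_mulrn ?powR_ge0// -powRrM -mulrA -powRD ?a0 ?implybT//.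
congr (_ * _ `^ _); rewrite -[(_ + _).+1%:R]natr1 natrD natrM -natr1; field.
exact: Mn0.
Qed.

(** Each step at least doubles the phase time, hence adds at least [min_time I]. Linear growth
    suffices for an Archimedean argument. *)
Lemma tau_ge gamma omega I k : 0 <= gamma -> -1 <= omega ->
  min_time I * k.+1%:R <= tau_ gamma omega I k.+1.
Proof.
move=> g0 o1; have m0 := min_time_ge0 I; elim: k => [|k IH].
  rewrite ler_wpM2l// -[leLHS](powRr0 (2 + gamma)) ler_powR; lra.
rewrite tau_S// -[k.+2%:R]natr1.
have t0 : min_time I <= tau_ gamma omega I k.+1.
  by rewrite (le_trans _ IH)// ler_peMr// ler1n.
have : 0 <= gamma * tau_ gamma omega I k.+1.
  by rewrite mulr_ge0// (le_trans m0).
by move: IH t0; lra.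
Qed.

Lemma tau_ge0 gamma omega I k : 0 <= tau_ gamma omega I k.
Proof. by rewrite mulr_ge0 ?min_time_ge0 ?powR_ge0. Qed.

End Schedules.

(** * Runs of Mimic and their cost *)

Section Mimic.
Variables (R : realType) (P : problem R) (gamma : R).
Variable S : input P -> R -> hist P.

(** Phases are counted from 0 here: phase [k] starts at tau_(k+1). *)
Definition phase_compl (omega : R) (I : input P) (k : nat) (r : job P)
    : \bar R :=
  let tau := tau_ gamma omega I k.+1 in compl (S (arrived I tau) tau) r.

Hypotheses (gamma_ge0 : 0 <= gamma) (hP : resettable P gamma).
Hypothesis hS : forall (I : input P) (tau : R), 0 <= tau ->
  best_schedule I tau (S (arrived I tau) tau).
Implicit Types (I : input P) (h A : hist P) (tau omega : R) (r : job P).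

(** Executing for time t and resetting for gamma t leads from t to (2 + gamma) t, the next phase
    time. Existence serves to build a run; the second half describes every run. *)
Lemma mimic_step I h A : execution I h -> at_init h ->
  tau_schedule I (now h) A ->
  (exists h'', exists2 h', executes h A h' & reset_in I (gamma * now h) h' h'')
  /\ forall h' h'', executes h A h' -> reset_in I (gamma * now h) h' h'' ->
     [/\ execution I h'', at_init h'', now h'' = (2 + gamma) * now h
       & forall r, compl h'' r = if completed h r then compl h r
                                 else ((now h)%:E + compl A r)%E].
Proof.
move=> eh ih sA; have [del res _] := hP.
have [[h0 eh0] delE] := del _ _ _ _ eh ih sA (lexx _); split.
  by have [h'' ?] := res _ _ _ _ _ eh ih sA (lexx _) eh0; exists h'', h0.
move=> h' h'' /delE[_ _ nh' ch'] [eh'' _ nh'' ih'' ch'']; split=> //.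
  by rewrite nh'' nh'; ring.
by move=> r; rewrite ch'' ch'.
Qed.

Lemma execution_idle I (t : R) : 0 <= t ->
  execution I (idle (job P) (init P) t).
Proof. by move=> t0; split=> //; exact: feasible_idle. Qed.

Lemma mimic_exists omega I : exists H, mimic S gamma omega I H.
Proof.
pose tau k := tau_ gamma omega I k.+1.
pose inv k h := [/\ execution I h, at_init h & now h = tau k].
pose next k h h'' := exists2 h', executes h (S (arrived I (tau k)) (tau k)) h'
                               & reset_in I (gamma * tau k) h' h''.
(* Placing [inv] inside the existential makes the statement total, as [choice] requires. *)
have step kh : exists h'', inv kh.1 kh.2 -> next kh.1 kh.2 h'' /\ inv kh.1.+1 h''.
  case: kh => k h /=; have [[eh ih nh]|] := pselect (inv k h); last by exists h.
  have sA := proj1 (hS I (tau_ge0 gamma omega I k.+1)).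
  rewrite -/(tau k) -{1}nh in sA.
  have [] := mimic_step eh ih sA; rewrite nh => -[h'' nx] all.
  exists h'' => _; split=> //.
  have [h' e r] := nx; have [? ? n _] := all _ _ e r; split=> //.
  by rewrite n /tau -tau_S.
have [f fP] := choice step.
pose H := fix H k := if k is k'.+1 then f (k', H k')
                     else idle (job P) (init P) (tau 0%N).
have Hinv k : inv k (H k).
  elim: k => [|k /(fP (k, _))[]//].
  by split=> //; exact/execution_idle/tau_ge0.
by exists H; split=> // k; have [] := fP (k, H k) (Hinv k).
Qed.

Lemma mimic_compl omega I H k : mimic S gamma omega I H ->
  [/\ execution I (H k), at_init (H k), now (H k) = tau_ gamma omega I k.+1
    & forall r, compl (H k) r =
      ((first_start (phase_compl omega I) (fun i => tau_ gamma omega I i.+1) k r)%:E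
       + first_compl (phase_compl omega I) k r)%E].
Proof.
move=> [H0 HS]; elim: k => [|k [ek ik nk ck]].
  by rewrite H0; split=> //; exact/execution_idle/tau_ge0.
have [h' eh' rh'] := HS k.
have sA := proj1 (hS I (tau_ge0 gamma omega I k.+1)).
rewrite -{1}nk in sA; have [_] := mimic_step ek ik sA; rewrite nk.
move=> /(_ _ _ eh' rh')[e i n c]; split=> //; first by rewrite n -tau_S.
move=> r; rewrite c /completed ck /= first_complS.
set D := first_compl _ k r.
have -> : ((first_start (phase_compl omega I) (fun i => tau_ gamma omega I i.+1) k r)%:E
  + D < +oo)%E = (D < +oo)%E by case: D => // x; rewrite -EFinD !ltry.
case: (boolP (D < +oo)%E) => [->//|Dy]; rewrite first_startE//.
rewrite -/(phase_compl omega I k r).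
by case: ifPn => //; rewrite -leNgt leye_eq => /eqP ->.
Qed.

Lemma capped_cost_le_opt I h : offline_solution I h ->
  cost I (compl h) = (\sum_(r <- I) weight r * fine (compl h r))%:E /\
  forall t, capped_cost I (@weight R P) (compl h) t
            <= \sum_(r <- I) weight r * fine (compl h r).
Proof.
move=> [[fh _] ch]; split=> [|t].
  rewrite /cost -sumEFin big_seq [RHS]big_seq; apply: eq_bigr => r /ch rc.
  by rewrite EFinM fineK// ge0_fin_numE// compl_ge0.
rewrite /capped_cost big_seq [leRHS]big_seq; apply: ler_sum => r /ch rc.
by rewrite ler_wpM2l ?weight_ge0// capped_le_fine.
Qed.

(** S_t is itself an execution of [I], so optimality of S_s applies; this supplies [C_mono]. *)
Lemma capped_cost_homo I s t : 0 <= s -> 0 <= t ->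
  capped_cost I (@weight R P) (compl (S (arrived I s) s)) s
  <= capped_cost I (@weight R P) (compl (S (arrived I t) t)) s.
Proof.
move=> s0 t0; apply: best_capped_cost => //; first exact: hS.
by have [/tau_schedule_execution] := hS I t0.
Qed.

(** The entries of the first serving phases cost at most the optimum. The condition on [k] ensures
    that phases 0 to [k] serve every job of positive weight. *)
Lemma mimic_cost omega I H opt k :
  mimic S gamma omega I H -> offline_solution I opt ->
  (forall r, r \in I -> 0 < weight r ->
     (cost I (compl opt) < (weight r * tau_ gamma omega I k.+1)%:E)%E) ->
  (cost I (run_compl H) <=
   (\sum_(r <- I) weight r *
      first_start (phase_compl omega I) (fun i => tau_ gamma omega I i.+1) k.+1 r)%:E
   + cost I (compl opt))%E.
Proof.
move=> hH hopt; have [-> OPT] := capped_cost_le_opt hopt.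
set opt_cost := \sum_(r <- I) _ * fine _; move=> big_k.
pose tau i := tau_ gamma omega I i.+1.
pose D := first_compl (phase_compl omega I).
have tau0 i : 0 <= tau i by exact: tau_ge0.
have phase_compl_le i r : (phase_compl omega I i r < +oo ->
    phase_compl omega I i r <= (tau i)%:E)%E.
  exact: tau_schedule_compl (proj1 (hS I (tau0 i))).
have tau_homo i : tau i <= tau i.+1.
  by rewrite /tau [leRHS]tau_S// ler_peMl ?tau_ge0//; move: gamma_ge0; lra.
have D_opt : capped_cost I (@weight R P) (D k.+1) (tau k) <= opt_cost.
  apply: le_trans (OPT (tau k)).
  apply: le_trans (best_capped_cost (tau0 k) (hS I (tau0 k)) (proj1 hopt)).
  apply: capped_cost_first_compl => //; first by move=> r; exact: weight_ge0.
  by move=> i; exact: (capped_cost_homo I (tau0 i) (tau0 i.+1)).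
have D_optE := D_opt; rewrite -lee_fin in D_optE.
apply: le_trans (leeD2l _ D_optE).
rewrite /capped_cost -EFinD -big_split -sumEFin /cost big_seq [leRHS]big_seq.
apply: lee_sum => r rI /=; rewrite -mulrDr EFinM.
(* A job of weight 0 may stay unserved, but costs 0 * +oo = 0. *)
have := weight_ge0 r; rewrite le_eqVlt => /predU1P[<-|wr].
  by rewrite !mul0e.
apply: lee_wpmul2l; first by rewrite lee_fin ltW.
(* An unserved job alone would contribute its weight times [tau k], exceeding the optimum, which
   bounds the whole capped cost. *)
have Dy : (D k.+1 r < +oo)%E.
  rewrite ltNge leye_eq; apply/negP => /eqP Dy.
  have := big_k r rI wr; rewrite ltNge => /negP; apply.
  rewrite lee_fin; apply: le_trans D_opt.
  rewrite /capped_cost (big_fsetD1 r)//= Dy cappedy lerDl sumr_ge0// => r' _.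
  rewrite mulr_ge0 ?weight_ge0// /capped; case: ifP => // D'y.
  rewrite le_min tau0 andbT.
  have: (0 <= D k.+1 r')%E.
    rewrite /D; elim: k.+1 => [|i IH]; first exact: leey.
    rewrite first_complS; case: ifP => // _.
    by apply: compl_ge0; have [/tau_schedule_execution[]] := hS I (tau0 i).
  exact: fine_ge0.
apply: (@le_trans _ _ (compl (H k.+1) r)).
  by apply: ereal_inf_lbound; exists k.+1.
have [_ _ _ ->] := mimic_compl k.+1 hH.
rewrite EFinD leeD2l// capped_id//; last exact: first_compl_le.
by move: Dy; rewrite -/D; case: (D k.+1 r) => // *; rewrite leNye.
Qed.

End Mimic.

(** * Averaging over the random offset *)

Theorem theorem2 (R : realType) (gamma : R) (M : nat) (beta : R)
    (P : problem R) (S : input P -> R -> hist P)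
    (hgamma : 0 <= gamma) (hM : (0 < M)%N)
    (hbeta0 : 0 < beta) (hbeta1 : beta <= M%:R^-1)
    (hP : resettable P gamma)
    (hS : forall (I : input P) (tau : R), 0 <= tau ->
       best_schedule I tau (S (arrived I tau) tau))
    (I : input P) :
  (forall m : 'I_M, exists H : nat -> hist P, disc S gamma beta m I H) /\
  (forall (opt : hist P) (H : 'I_M -> nat -> hist P),
     optimal I opt ->
     (forall m : 'I_M, disc S gamma beta m I (H m)) ->
     (expected_cost I H <=
      (1 + M%:R^-1 * \sum_(1 <= j < M.+1) (2 + gamma) `^ (j%:R / M%:R))%:E
      * cost I (compl opt))%E).
Proof.
split=> [m|opt H [hopt _] hH]; first exact: mimic_exists.
have [->|I0] := eqVneq I fset0.
  rewrite /expected_cost /cost !big_seq_fset0 big1 ?mule0// => m _.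
  by rewrite big_seq_fset0.
have mn0 : 0 < min_time I by have [_ _ /(_ I I0)[]] := hP.
have [costE capped_opt] := capped_cost_le_opt hopt.
pose OPT := \sum_(r <- I) weight r * fine (compl opt r).
have OPT0 : 0 <= OPT.
  rewrite sumr_ge0// => r _; rewrite mulr_ge0 ?weight_ge0// fine_ge0//.
  by apply: compl_ge0; have [[]] := hopt.
pose W := \sum_(r <- I) weight r.
pose q := (2 + gamma) `^ M%:R^-1.
have q1 : 1 <= q.
  rewrite /q -[leLHS](powRr0 (2 + gamma)) ler_powR ?invr_ge0//; lra.
pose s0 := min_time I * (2 + gamma) `^ (beta - M%:R^-1).
have s00 : 0 <= s0 by rewrite mulr_ge0 ?powR_ge0 ?ltW.
pose s n := s0 * q ^+ n.
have sge0 n : 0 <= s n by rewrite mulr_ge0// exprn_ge0 ?powR_ge0.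
have s_homo n : s n <= s n.+1.
  by rewrite /s exprSr mulrA ler_peMr// sge0.
(* Since beta is at most 1/M, no execution completes a job before s_0, which starts the induction
   behind [grid]. *)
have s0_le : s 0%N <= min_time I.
  rewrite /s mulr1 ler_piMr ?(ltW mn0)// -[leRHS](powRr0 (2 + gamma)).
  rewrite ler_powR ?subr_le0//; lra.
pose served n r := compl (S (arrived I (s n)) (s n)) r.
pose unserved n := \sum_(r <- I) weight r * (served n r == +oo%E)%:R.
have grid N : s0 * W + \sum_(0 <= n < N) (s n.+1 - s n) * unserved n.+1 <= OPT.
  rewrite -[s0]mulr1; apply: le_trans (capped_opt (s N)).
  have best := best_capped_cost (sge0 N) (hS I _ (sge0 N)) (proj1 hopt).
  apply: le_trans best.
  apply: (@capped_cost_unserved _ _ _ _ served s) => [r|n|n|r].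
  - exact: weight_ge0.
  - exact: s_homo.
  - exact: capped_cost_homo.
  - apply: le_trans (min_time_le r (tau_schedule_execution (proj1 (hS I _ (sge0 0%N))))).
    by rewrite lee_fin.
have [k big_k] : exists k : nat, forall r, r \in I -> 0 < weight r ->
    OPT < weight r * (min_time I * k.+1%:R).
  (* The sum dominates each of its terms; jobs of weight 0 contribute 0, as division by 0 gives
     0. *)
  exists (Num.bound (\sum_(r <- I) OPT / weight r / min_time I)) => r rI wr.
  have B0 (r' : job P) : 0 <= OPT / weight r' / min_time I.
    by rewrite !divr_ge0 ?weight_ge0// ltW.
  rewrite mulrA -ltr_pdivrMl ?mulr_gt0// invfM mulrC mulrA.
  apply: (@le_lt_trans _ _ (\sum_(r <- I) OPT / weight r / min_time I)).
    by rewrite (big_fsetD1 r)//= lerDl sumr_ge0.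
  apply: lt_le_trans (archi_boundP _) _; first by rewrite sumr_ge0.
  by rewrite ler_nat.
pose run_bound m := s m.+1 * W
  + \sum_(0 <= i < k.+1) (s (i.+1 * M + m).+1 - s (i * M + m).+1)
      * unserved (i * M + m).+1.
have run (m : 'I_M) : (cost I (run_compl (H m)) <= (run_bound m + OPT)%:E)%E.
  pose omega := -1 + (m : nat)%:R / M%:R + beta.
  have tauE i : tau_ gamma omega I i.+1 = s (i * M + m).+1.
    exact: tau_geometric.
  have o1 : -1 <= omega.
    have : 0 <= (m : nat)%:R / M%:R :> R by rewrite divr_ge0.
    by rewrite /omega; lra.
  apply: le_trans (@mimic_cost _ _ _ _ hgamma hP hS _ _ _ _ k (hH m) hopt _) _.
    move=> r rI wr; rewrite costE lte_fin (lt_le_trans (big_k r rI wr))//.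
    by rewrite ler_wpM2l ?weight_ge0// tau_ge.
  rewrite costE -EFinD lee_fin lerD2r /run_bound.
  have tau_homo i : tau_ gamma omega I i.+1 <= tau_ gamma omega I i.+2.
    by rewrite [leRHS]tau_S// ler_peMl ?tau_ge0//; lra.
  have start_le r := @first_start_le _ _ (phase_compl gamma S omega I)
    (fun i => tau_ gamma omega I i.+1) tau_homo k.+1 r.
  apply: le_trans (ler_sum _ (fun r _ => ler_wpM2l (weight_ge0 r) (start_le r))) _.
  (* Exchanging the sums over jobs and phases gives [run_bound m] exactly. *)
  rewrite le_eqVlt; apply/orP; left; apply/eqP.
  under eq_bigr do rewrite mulrDr mulr_sumr.
  rewrite big_split exchange_big /=; congr (_ + _).
    by rewrite -mulr_suml mulrC tauE mul0n add0n.
  apply: eq_bigr => i _; rewrite mulr_sumr; apply: eq_bigr => r _.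
  by rewrite /phase_compl !tauE mulrCA.
have qE j : (2 + gamma) `^ (j%:R / M%:R) = q ^+ j.
  by rewrite -powR_mulrn ?powR_ge0// -powRrM mulrC.
under eq_bigr do rewrite qE.
set Q := \sum_(1 <= j < M.+1) q ^+ j.
have Q0 : 0 <= Q by apply: sumr_ge0 => j _; rewrite exprn_ge0 ?powR_ge0.
(* This is [grid] at N = (k + 1) M, multiplied by q + ... + q^M. *)
have sum_runs : \sum_(m < M) run_bound m <= Q * OPT.
  rewrite -(big_mkord xpredT run_bound).
  rewrite (geometric_phases q s0 W (fun n => unserved n.+1)) ler_wpM2l//.
have M_gt0 : 0 < M%:R :> R by rewrite ltr0n.
apply: (@le_trans _ _ (M%:R^-1 * \sum_(m < M) (run_bound m + OPT))%:E).
  rewrite /expected_cost EFinM lee_wpmul2l ?lee_fin ?invr_ge0 ?ler0n//.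
  by rewrite -sumEFin; apply: lee_sum => m _; exact: run.
rewrite costE -/OPT -EFinM lee_fin ler_pdivrMl// big_split /= sumr_const card_ord.
have -> : M%:R * ((1 + M%:R^-1 * Q) * OPT) = Q * OPT + OPT *+ M.
  by rewrite -mulr_natr; field; rewrite gt_eqF.
by rewrite lerD2r.
Qed.
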